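(* The function $E_1\times N\times V^*\ni(u,x,p)\mapsto\frac{1}{2m}\langle p,g'(p)\rangle+\langle p,u\rangle$ is constant on the equivalence classes $(x,[u,p])$ and so projects to a function $\Psi_m$ on $N\times P$; and the family of functions $$-\widetilde H_h:N\times P\times\mathbb{R}_+\to\mathbb{R},\qquad \widetilde H_h(x,\mathbf{p},r)=r\,(\Psi_m(x,\mathbf{p})+\varphi(x)),$$ fibred over $N\times P$ by $(x,\mathbf{p},r)\mapsto(x,\mathbf{p})$, is a generating object of the frame-independent dynamics $D_h$; that is, it generates $\beta(D_h)\subset\mathsf{T}^*(N\times P)$.
   Context: Newtonian space-time: $N$ is a four-dimensional real affine space with model vector space $V$, $\tau\in V^*$ is non-zero, $E_0=\ker\tau$, and $g:E_0\to E_0^*$ is a Euclidean metric (symmetric, positive definite). $\imath:E_0\to V$ is the inclusion, $\imath^*:V^*\to E_0^*$ its dual, and $g'=\imath\circ g^{-1}\circ\imath^*:V^*\to V$. $E_1=\{v\in V:\langle\tau,v\rangle=1\}$ (inertial frames), $V^+=\{v\in V:\langle\tau,v\rangle>0\}$, $\mathbb{R}_+=(0,\infty)$. For $u\in E_1$, $\imath_u:V\to E_0$, $\imath_u(v)=v-\langle\tau,v\rangle u$, and $\imath_u^*:E_0^*\to V^*$ is its dual. $m>0$ is the mass and $\varphi:N\to\mathbb{R}$ is a smooth potential. For $u,u'\in E_1$ put $\sigma(u',u)=\imath^*_{(u+u')/2}(g(u'-u))\in V^*$. The space $P$: the quotient of $E_1\times V^*$ by the equivalence relation $(u,p)\sim(u',p')$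 iff $p=p'+m\sigma(u',u)$; classes are written $[u,p]$. $P$ is an affine space modelled on $V^*$ by $[u,p]+\pi=[u,p+\pi]$. Hence $\mathsf{T}(N\times P)\simeq N\times P\times V\times V^*$ and $\mathsf{T}^*(N\times P)\simeq N\times P\times V^*\times V$. The map $\beta:\mathsf{T}(N\times P)\to\mathsf{T}^*(N\times P)$ is $\beta(x,\mathbf{p},v,a)=(x,\mathbf{p},a,-v)$. Dynamics: $D_{h,u}\subset\mathsf{T}\mathsf{T}^*N\simeq N\times V^*\times V\times V^*$ is the set of $(x,p,\dot x,\dot p)$ such that for some $v\in V^+$: $\dot x=v$, $\dot p=-\langle\tau,v\rangle\,\mathrm{d}\varphi(x)$ and $p=\frac{m}{\langle\tau,v\rangle}\imath_u^*(g(\imath_u(v)))-\frac{m}{2\langle\tau,v\rangle^2}\langle g(\imath_u(v)),\imath_u(v)\rangle\tau-\varphi(x)\tau$. The frame-independent dynamics is $D_h=\{(x,[u,p],\dot x,\dot p):(x,p,\dot x,\dot p)\in D_{h,u}\}\subset\mathsf{T}(N\times P)$, which does not depend on $u\in E_1$. Generating families: given a surjective submersion $\zeta:X\to B$ and a smooth function $F:X\to\mathbb{R}$, the subset of $\mathsf{T}^*B$ generated by $F$ is the set of covectors $b\in\mathsf{T}^*_{q}B$, $q\in B$, for which there is $y\in\zeta^{-1}(q)$ with $\mathrm{d}F(y)=b\circ\mathsf{T}_y\zeta$. *)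

(* Defs.v *)
From HB Require Import structures.
From mathcomp Require Import all_boot all_order all_algebra.
From mathcomp Require Import generic_quotient.
From mathcomp Require Import ring.
From mathcomp Require Import all_classical all_reals all_analysis.

Set Implicit Arguments.
Unset Strict Implicit.
Unset Printing Implicit Defensive.

Import Order.TTheory GRing.Theory Num.Theory.
Import numFieldNormedType.Exports.
Local Open Scope classical_set_scope.
Local Open Scope ring_scope.
Local Open Scope quotient_scope.

(* Throughout, the dual of a vector space [V] is ['Hom(V, R^o)]. *)

(* [asub y x] is the unique vector carrying [x] to [y]. *)
Record affine (R : realType) (V : vectType R) := Affine {
  apoint :> Type;
  aadd : apoint -> V -> apoint;
  asub : apoint -> apoint -> V;
  affine_inhabited : inhabited apoint;
  aadd0 : forall x, aadd x 0 = x;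
  aaddA : forall x v w, aadd (aadd x v) w = aadd x (v + w);
  asubK : forall x y, aadd x (asub y x) = y;
  aaddK : forall x v, asub (aadd x v) x = v }.

Section AffineConstructions.
Context (R : realType).
Local Obligation Tactic := idtac.

Program Definition vect_affine (V : vectType R) : affine V :=
  @Affine R V V (fun x v => x + v) (fun y x => y - x) (inhabits 0) _ _ _ _.
Next Obligation. by move=> V x /=; rewrite addr0. Qed.
Next Obligation. by move=> V x v w /=; rewrite addrA. Qed.
Next Obligation. by move=> V x y /=; rewrite addrC subrK. Qed.
Next Obligation. by move=> V x v /=; rewrite addrAC subrr add0r. Qed.

Program Definition prod_affine (V W : vectType R) (A : affine V) (B : affine W)
    : affine (V * W)%type :=
  @Affine R (V * W)%type (A * B)%type
    (fun x v => (aadd x.1 v.1, aadd x.2 v.2))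
    (fun y x => (asub y.1 x.1, asub y.2 x.2)) _ _ _ _ _.
Next Obligation.
by move=> V W A B; case: (affine_inhabited A) => a; case: (affine_inhabited B).
Qed.
Next Obligation. by move=> V W A B [x y]; rewrite /= !aadd0. Qed.
Next Obligation. by move=> V W A B [x y] v w; rewrite /= !aaddA. Qed.
Next Obligation. by move=> V W A B [x y] [x' y']; rewrite /= !asubK. Qed.
Next Obligation. by move=> V W A B [x y] [v w]; rewrite /= !aaddK. Qed.

End AffineConstructions.

(* A [vectType] carries no topology, so differential calculus is transported
   from the normed space of row vectors through the coordinates of a basis;
   since all norms on a finite-dimensional space are equivalent, the notions
   below do not depend on the basis. *)
Section Calculus.
Context (R : realType).

Definition coords (V : vectType R) : V -> 'rV[R]_(\dim {:V}) :=
  passmx.rVof (vbasis {:V}).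
Definition uncoords (V : vectType R) : 'rV[R]_(\dim {:V}) -> V :=
  passmx.vecof (vbasis {:V}).

Definition affine_open (V : vectType R) (A : affine V) (U : set A) : Prop :=
  forall x, U x ->
    \forall h \near (0 : 'rV[R]_(\dim {:V})), U (aadd x (uncoords h)).

(* The increment of [f] at [x], in coordinates. *)
Definition increment (V W : vectType R) (A : affine V) (B : affine W)
    (f : A -> B) (x : A) : 'rV[R]_(\dim {:V}) -> 'rV[R]_(\dim {:W}) :=
  fun h => coords (asub (f (aadd x (uncoords h))) (f x)).

Definition continuous_at (V W : vectType R) (A : affine V) (B : affine W)
    (f : A -> B) (x : A) : Prop :=
  {for 0, continuous (increment f x)}.

Definition differentiable_at (V W : vectType R) (A : affine V) (B : affine W)
    (f : A -> B) (x : A) : Prop :=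
  differentiable (increment f x) 0.

Definition tangent (V W : vectType R) (A : affine V) (B : affine W)
    (f : A -> B) (x : A) : 'Hom(V, W) :=
  linfun (fun v => uncoords ('d (increment f x) 0 (coords v))).

(* Class [C^k] on the open set [U]: a map is [C^(k+1)] when it is
   differentiable and its derivatives along all fixed vectors are [C^k].
   Only the values on [U] matter. *)
Fixpoint Ck (k : nat) (V W : vectType R) (A : affine V) (B : affine W)
    (U : set A) (f : A -> B) : Prop :=
  if k is k'.+1 then
    (forall x, U x -> differentiable_at f x) /\
    (forall v : V, Ck k' (B := vect_affine W) U (fun x => tangent f x v))
  else forall x, U x -> continuous_at f x.

Definition smooth (V W : vectType R) (A : affine V) (B : affine W)
    (U : set A) (f : A -> B) : Prop :=
  forall k, Ck k U f.

Definition smooth_fun (V : vectType R) (A : affine V) (U : set A)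
    (f : A -> R) : Prop :=
  smooth (B := vect_affine R^o) U f.

Definition differential (V : vectType R) (A : affine V) (f : A -> R) (x : A) :
    'Hom(V, R^o) :=
  tangent (B := vect_affine R^o) f x.

End Calculus.

(* The total space [X] of a family is an open subset [U] of an affine space;
   functions on [X] are given by functions on the ambient space, of which only
   the values on [U] are used.  Covectors of an affine space [B] modelled on
   [W] are pairs of a point and an element of the dual of [W]. *)
Section GeneratingFamilies.
Context (R : realType) (V W : vectType R) (A : affine V) (B : affine W).

Definition surjective_submersion (U : set A) (zeta : A -> B) : Prop :=
  [/\ affine_open U,
      smooth U zeta,
      forall y, U y -> limg (tangent zeta y) = fullv
    & forall q : B, exists2 y, U y & zeta y = q].

Definition generated (U : set A) (zeta : A -> B) (F : A -> R) :
    set (B * 'Hom(W, R^o)) :=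
  [set b | exists y, [/\ U y, zeta y = b.1
    & differential F y = (b.2 \o tangent zeta y)%VF]].

Definition generates (U : set A) (zeta : A -> B) (F : A -> R)
    (D : set (B * 'Hom(W, R^o))) : Prop :=
  [/\ surjective_submersion U zeta, smooth_fun U F & generated U zeta F = D].

End GeneratingFamilies.

Record newtonian (R : realType) := Newtonian {
  nV : vectType R;
  nN : affine nV;
  ntau : 'Hom(nV, R^o);
  ng : 'Hom(subvs_of (lker ntau), 'Hom(subvs_of (lker ntau), R^o));
  nV_dim : \dim {:nV} = 4%N;
  ntau_neq0 : ntau != 0;
  ng_sym : forall e f, ng e f = ng f e;
  ng_pos : forall e, e != 0 -> (0 : R) < ng e e }.

Section Newtonian.
Context (R : realType) (S : newtonian R).
Local Notation N := (nN S).
Local Notation V := (nV S).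
Local Notation Vd := ('Hom(nV S, R^o)).
Local Notation tau := (ntau S).
Local Notation g := (ng S).

Definition E0 : vectType R := subvs_of (lker tau).
Definition E1 : choiceType := {v : V | tau v == 1}.

Definition inclusion : 'Hom(E0, V) := linfun vsval.

(* [g^-1] is the inverse of a bijection, as [g] is positive definite. *)
Definition gprime (p : Vd) : V :=
  inclusion ((g^-1)%VF (p \o inclusion)%VF).

(* [vsproj] is a projection onto [E0]; it only casts its argument, which
   belongs to [E0] as soon as [tau u = 1]. *)
Definition iota_ (u : V) : 'Hom(V, E0) :=
  linfun (fun v => vsproj (lker tau) (v - (tau v : R) *: u)).

Definition iota_dual (u : V) (q : 'Hom(E0, R^o)) : Vd := (q \o iota_ u)%VF.

Definition sigma (u' u : E1) : Vd :=
  iota_dual (2^-1 *: (val u + val u')) (g (vsproj (lker tau) (val u' - val u))).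

Fact E1B (u u' : E1) : val u - val u' \in lker tau.
Proof. by rewrite memv_ker linearB /= (eqP (valP u)) (eqP (valP u')) subrr. Qed.

Lemma inclusionE (e : E0) : inclusion e = vsval e.
Proof. exact: lfunE. Qed.

Fact iota_linear (u : V) :
  linear (fun v : V => vsproj (lker tau) (v - (tau v : R) *: u)).
Proof.
move=> a x y; rewrite -linearP; congr (vsproj _ _).
rewrite linearP /= scalerDl opprD addrACA scalerBr scalerA; congr (_ + _).
Qed.

Lemma iotaE (u v : V) : iota_ u v = vsproj (lker tau) (v - (tau v : R) *: u).
Proof.
pose F : {linear V -> E0} := HB.pack (fun v : V => _)
  (GRing.isLinear.Build R V E0 *:%R _ (iota_linear u)).
exact: (lfunE F).
Qed.

Fact midpoint (t : R) (v a b : V) :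
  v - t *: (2^-1 *: (a + b)) = (v - t *: a) - (t / 2) *: (b - a).
Proof.
rewrite -addrA -opprD scalerA [t in t *: a]splitr scalerDl -addrA -scalerDr.
by rewrite [a + (b - a)]addrC subrK scalerDr.
Qed.

Fact gDl (a b c : E0) : g (a + b) c = g a c + g b c.
Proof. by rewrite linearD add_lfunE. Qed.

Fact gZl (t : R) (a c : E0) : g (t *: a) c = t * g a c.
Proof. by rewrite linearZ scale_lfunE. Qed.

Fact gDr (a b c : E0) : g c (a + b) = g c a + g c b.
Proof. exact: linearD. Qed.

Fact gZr (t : R) (a c : E0) : g c (t *: a) = t * g c a.
Proof. exact: linearZ. Qed.

Lemma sigmaE (u' u : E1) (v : V) (d := vsproj (lker tau) (val u' - val u)) :
  sigma u' u v =
  g d (vsproj (lker tau) (v - (tau v : R) *: val u)) - tau v / 2 * g d d.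
Proof.
rewrite /sigma /iota_dual comp_lfunE iotaE -/d midpoint.
have -> (x y : V) (t : R) : vsproj (lker tau) (x - t *: y) =
    vsproj (lker tau) x + (- t) *: vsproj (lker tau) y.
  by rewrite linearB linearZ scaleNr.
by rewrite gDr gZr mulNr.
Qed.

Lemma sigma_cocycle (u'' u' u : E1) :
  sigma u'' u = sigma u'' u' + sigma u' u.
Proof.
apply/lfunP => v; rewrite add_lfunE !sigmaE.
set d1 := vsproj _ (val u' - val u); set d2 := vsproj _ (val u'' - val u').
have -> : vsproj (lker tau) (val u'' - val u) = d2 + d1.
  by rewrite -linearD addrA subrK.
have -> : vsproj (lker tau) (v - (tau v : R) *: val u') =
    vsproj (lker tau) (v - (tau v : R) *: val u) + (- (tau v : R)) *: d1.
  rewrite /d1 -linearZ -linearD; congr (vsproj _ _).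
  by rewrite scaleNr -addrA -opprD -scalerDr [val u + _]addrC subrK.
set e := vsproj _ (v - _).
rewrite !gDl !gDr !gZr (ng_sym d1 d2).
have id6 (t a b c k l : R) :
  a + b - t / 2 * (c + k + (k + l)) =
  a + - t * k - t / 2 * c + (b - t / 2 * l) by field.
exact: id6.
Qed.

Lemma sigma_id (u : E1) : sigma u u = 0.
Proof.
by have /eqP := sigma_cocycle u u u; rewrite addrC -subr_eq subrr => /eqP.
Qed.

Lemma sigmaC (u u' : E1) : sigma u u' = - sigma u' u.
Proof. by apply/eqP; rewrite -addr_eq0 -sigma_cocycle sigma_id. Qed.

Section PhaseSpace.
Variables (m : R) (phi : N -> R).

Definition frame_rel : rel (E1 * Vd) :=
  fun a b => a.2 == b.2 + m *: sigma b.1 a.1.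

Fact frame_rel_refl : reflexive frame_rel.
Proof. by move=> [u p]; rewrite /frame_rel sigma_id scaler0 addr0. Qed.

Fact frame_rel_sym : symmetric frame_rel.
Proof.
move=> [u p] [u' p']; rewrite /frame_rel /= [sigma u u']sigmaC scalerN.
by rewrite eq_sym [RHS]eq_sym subr_eq.
Qed.

Fact frame_rel_trans : transitive frame_rel.
Proof.
move=> [u p] [u' p'] [u'' p'']; rewrite /frame_rel /= => /eqP-> /eqP->.
by rewrite -addrA -scalerDr -sigma_cocycle.
Qed.

Canonical frame_equiv :=
  EquivRel frame_rel frame_rel_refl frame_rel_sym frame_rel_trans.

Definition phase : choiceType := {eq_quot frame_equiv}.

Definition cls (u : E1) (p : Vd) : phase := \pi_(phase) (u, p).

Definition phase_add (P : phase) (pi : Vd) : phase :=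
  cls (repr P).1 ((repr P).2 + pi).

Definition phase_sub (Q P : phase) : Vd :=
  (repr Q).2 - ((repr P).2 + m *: sigma (repr P).1 (repr Q).1).

Lemma cls_eqP (u u' : E1) (p p' : Vd) :
  cls u p = cls u' p' <-> p = p' + m *: sigma u' u.
Proof.
split=> [/eqP|pE]; first by rewrite eqmodE => /eqP.
by apply/eqP; rewrite eqmodE; apply/eqP.
Qed.

Lemma phase_addE (u : E1) (p pi : Vd) :
  phase_add (cls u p) pi = cls u (p + pi).
Proof.
rewrite /phase_add; case E: (repr (cls u p)) => [u' p'] /=.
have /cls_eqP-> : cls u' p' = cls u p.
  by rewrite -[RHS]reprK E.
by apply/cls_eqP; rewrite addrAC.
Qed.

Fact phase_inhabited : inhabited phase.
Proof.
have [v tv0] : exists v, tau v != 0.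
  apply: contrapT => /forallNP tau0; have /negP := ntau_neq0 S; apply.
  by apply/eqP/lfunP => v; rewrite zero_lfunE; apply/eqP/negPn/negP/tau0.
have tv1 : tau ((tau v : R)^-1 *: v) == 1.
  by rewrite linearZ /=; apply/eqP; exact: mulVf.
exact: inhabits (cls (exist (fun v : V => tau v == 1) _ tv1 : E1) 0).
Qed.

Fact phaseP (P : phase) : exists u p, P = cls u p.
Proof.
by exists (repr P).1, (repr P).2; rewrite /cls -surjective_pairing reprK.
Qed.

Fact phase_add0 (P : phase) : phase_add P 0 = P.
Proof. by have [u [p ->]] := phaseP P; rewrite phase_addE addr0. Qed.

Fact phase_addA (P : phase) (pi pi' : Vd) :
  phase_add (phase_add P pi) pi' = phase_add P (pi + pi').
Proof.
by have [u [p ->]] := phaseP P; rewrite !phase_addE addrA.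
Qed.

Fact phase_subK (P Q : phase) : phase_add P (phase_sub Q P) = Q.
Proof.
rewrite /phase_add /phase_sub -[RHS]reprK.
case: (repr P) (repr Q) => u p [u' p'] /=; apply/cls_eqP.
by rewrite [sigma u u']sigmaC scalerN opprB addrC -addrA subrK.
Qed.

Fact phase_addK (P : phase) (pi : Vd) : phase_sub (phase_add P pi) P = pi.
Proof.
rewrite /phase_sub /phase_add; case EP: (repr P) => [u p] /=.
case EQ: (repr _) => [u' p'] /=.
have /cls_eqP-> : cls u' p' = cls u (p + pi) by rewrite -[RHS]reprK EQ.
by rewrite opprD addrACA subrr addr0 addrAC subrr add0r.
Qed.

Definition phase_space : affine Vd :=
  Affine phase_inhabited phase_add0 phase_addA phase_subK phase_addK.

Definition NP : affine (V * Vd)%type := prod_affine N phase_space.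

(* [T T^*N = N * V^* * V * V^*], bracketed as [(x, p), (xdot, pdot)]. *)
Definition D_hu (u : E1) : set ((N * Vd) * (V * Vd)) :=
  [set z : (N * Vd) * (V * Vd) | let: ((x, p), (xdot, pdot)) := z in
    exists v : V,
      let t : R := tau v in
      let w := iota_ (val u) v in
      [/\ 0 < t,
          xdot = v,
          pdot = - t *: differential phi x
        & p = (m / t) *: iota_dual (val u) (g w)
              - (m / (2 * t ^+ 2) * g w w) *: tau
              - phi x *: tau]].

Definition D_h : set (NP * (V * Vd)) :=
  [set z : NP * (V * Vd) | let: ((x, P), (xdot, pdot)) := z in
    exists (u : E1) (p : Vd), P = cls u p /\ D_hu u ((x, p), (xdot, pdot))].

(* The identification of [V^* * V] with the dual of [V * V^*]. *)
Definition covector (a : Vd) (w : V) : 'Hom((V * Vd)%type, R^o) :=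
  linfun (fun h : V * Vd => (a h.1 + h.2 w : R^o)).

Lemma covectorE (a : Vd) (w : V) (h : V * Vd) :
  covector a w h = a h.1 + h.2 w.
Proof.
pose f (h : V * Vd) : R^o := a h.1 + h.2 w.
have fl : linear f.
  move=> t [x p] [y q]; rewrite /f /= linearP add_lfunE scale_lfunE.
  by rewrite scalerDr addrACA.
pose F : {linear (V * Vd)%type -> R^o} := HB.pack f
  (GRing.isLinear.Build R (V * Vd)%type R^o *:%R f fl).
exact: (lfunE F).
Qed.

Definition beta (z : NP * (V * Vd)) : NP * 'Hom((V * Vd)%type, R^o) :=
  (z.1, covector z.2.2 (- z.2.1)).

(* The function whose projection to [N * P] is [Psi_m]. *)
Definition psi (u : E1) (x : N) (p : Vd) : R :=
  (2 * m)^-1 * p (gprime p) + p (val u).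

(* [N * P * R_+] is the open subset [half_space] of [N * P * R]. *)
Definition NPR : affine ((V * Vd) * R^o)%type :=
  prod_affine NP (vect_affine R^o).

Definition half_space : set NPR := [set y | (0 : R) < y.2].

Definition H_h (Psi : NP -> R) (y : NPR) : R :=
  let: ((x, P), r) := y in r * (Psi (x, P) + phi x).

End PhaseSpace.

End Newtonian.

Arguments D_h {R S} m phi _.
Arguments beta {R S m} z.
Arguments half_space {R} S m _.
Arguments H_h {R S m} phi Psi y.

(* Main.v *)
Require Import Defs.
From HB Require Import structures.
From mathcomp Require Import all_boot all_order all_algebra.
From mathcomp Require Import ring.
From mathcomp Require Import all_classical all_reals all_analysis.

Set Implicit Arguments.
Unset Strict Implicit.
Unset Printing Implicit Defensive.

Import Order.TTheory GRing.Theory Num.Theory.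
Import numFieldNormedType.Exports.
Local Open Scope classical_set_scope.
Local Open Scope ring_scope.

(* A momentum [p] is determined, for a given frame [u], by the vector
   [e = g^-1 (p o i)] of E0 and the number [p u], and
   [psi = (g e e) / (2 m) + p u].  Passing from [(u', p')] to [(u, p)] adds
   [m (u' - u)] to [e], and the resulting terms cancel in [psi].
   The [r]-component of the differential of [- r (Psi + phi)] vanishes exactly
   on the mass shell [Psi + phi = 0]; its other components read
   [xdot = r (g' p / m + u)] and [pdot = - r dphi].  Since then [tau xdot = r],
   solving for [p] yields the equations that define [D_hu u]. *)

(** * Differential calculus on affine spaces *)

(** Expanding a row in the canonical basis makes [f] a finite sum of coordinate forms times fixed
    vectors, each of them differentiable. *)
Lemma rV_linear_continuous (R : realType) (n : nat) (W : normedModType R)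
  (f : {linear 'rV[R]_n -> W}) : continuous f.
Proof.
have -> : f = \sum_(i < n) (fun h : 'rV[R]_n => h 0 i *: f (delta_mx 0 i))
    :> (_ -> _).
  apply/funext => h; rewrite fct_sumE {1}[h]row_sum_delta linear_sum.
  by apply: eq_bigr => i _; rewrite linearZ.
move=> x; apply: differentiable_continuous; apply: differentiable_sum => i.
exact/differentiableZl/differentiable_coord.
Qed.

Section Coordinates.
Context (R : realType) (V : vectType R).

Fact coords_is_linear : linear (@coords R V).
Proof. exact: passmx.rVof_linear. Qed.
HB.instance Definition _ := GRing.isLinear.Build R V _ *:%R (@coords R V)
  coords_is_linear.

Fact uncoords_is_linear : linear (@uncoords R V).
Proof. exact: passmx.vecof_linear. Qed.
HB.instance Definition _ := GRing.isLinear.Build R _ V *:%R (@uncoords R V)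
  uncoords_is_linear.

Lemma coordsK : cancel (@coords R V) (@uncoords R V).
Proof. exact/passmx.rVofK/vbasisP. Qed.

Lemma uncoordsK : cancel (@uncoords R V) (@coords R V).
Proof. exact/passmx.vecofK/vbasisP. Qed.

End Coordinates.

Lemma dim_dual (R : realType) (V : vectType R) :
  \dim {: 'Hom(V, R^o)} = \dim {:V}.
Proof. by rewrite !dimvf; exact: (muln1 (dim V)). Qed.

(** * Tangent maps and differentials as relations *)

Section Tangents.
Context (R : realType) (V W : vectType R) (A : affine V) (B : affine W).

(** Differentiability and the value of the derivative are kept in one relation, so that each rule
    for [is_diff] yields both at once. *)
Definition has_tangent (f : A -> B) (x : A) (L : 'Hom(V, W)) : Prop :=
  is_diff 0 (increment f x) (fun h => coords (L (uncoords h))).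

Lemma has_tangentP (f : A -> B) x L :
  has_tangent f x L <-> differentiable_at f x /\ tangent f x = L.
Proof.
split=> [fL|[df <-]].
  split; first exact: (@ex_diff _ _ _ _ _ _ _ fL).
  apply/lfunP => v.
  rewrite /tangent (@diff_val _ _ _ _ _ _ _ fL) -[RHS]lfunE /=.
  by congr (linfun _ v); apply/funext => w; rewrite !coordsK.
apply: DiffDef => //; apply/funext => h; rewrite /tangent.
(* [linfun] is known to return its argument only when that argument is linear, so the map is
   presented as a composite of linear maps. *)
pose F : {linear V -> W} :=
  @uncoords R W \o 'd (increment f x) 0 \o @coords R V.
by rewrite (lfunE F) /= !uncoordsK.
Qed.

(** In coordinates the increment of an affine map is its linear part at every point, and a
    continuous linear map is its own differential. *)
Lemma has_tangent_affine (f : A -> B) (L : 'Hom(V, W)) :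
  (forall x v, f (aadd x v) = aadd (f x) (L v)) -> forall x, has_tangent f x L.
Proof.
move=> fL x; rewrite /has_tangent.
pose F : {linear 'rV_(\dim {:V}) -> 'rV_(\dim {:W})} :=
  @coords R W \o L \o @uncoords R V.
have -> : increment f x = F.
  by apply/funext => h; rewrite /increment fL aaddK.
have cF : continuous F by exact: rV_linear_continuous.
by apply: DiffDef; [exact: linear_differentiable | rewrite diff_lin].
Qed.

End Tangents.

(** The basis chosen for the line [R^o] need not be [1]; the coordinate row of [s] is [s] times the
    fixed row [coords 1]. *)
Lemma coords_diff (R : realType) (r : R) :
  is_diff r (@coords R R^o) (fun s => @coords R R^o s).
Proof.
have -> : @coords R R^o = *:%R^~ (coords (1 : R^o)) :> (R -> _).
  apply/funext => s; rewrite -linearZ; congr coords.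
  by rewrite /GRing.scale /= mulr1.
exact: is_diff_scalel.
Qed.

Lemma uncoords_diff (R : realType) (h : 'rV[R]_(\dim {:R^o})) :
  is_diff h (@uncoords R R^o : _ -> R) (fun s => @uncoords R R^o s).
Proof.
pose F : {linear 'rV[R]_(\dim {:R^o}) -> R} := @uncoords R R^o.
have cF : continuous F by exact: rV_linear_continuous.
by apply: DiffDef; [exact: linear_differentiable | rewrite (diff_lin _ cF)].
Qed.

Section Differentials.
Context (R : realType) (V : vectType R) (A : affine V).
Implicit Types (f g : A -> R) (L M : 'Hom(V, R^o)).

Definition has_differential f x L : Prop :=
  has_tangent (B := vect_affine R^o) f x L.

(** Removing the coordinates of the target leaves a real function of a row vector, to which the
    usual sum and product rules apply. *)
Lemma has_differentialE f x L :
  has_differential f x L <->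
  is_diff (0 : 'rV[R]_(\dim {:V})) (fun h => f (aadd x (uncoords h)) : R)
    (fun h => L (uncoords h) : R).
Proof.
rewrite /has_differential /has_tangent; split=> fL.
  set s := (fun h => _).
  have -> : s = cst (f x) +
      (@uncoords R R^o \o increment (B := vect_affine R^o) f x).
    by apply/funext => h; rewrite /s fctE /= /increment coordsK /= addrC subrK.
  have u := uncoords_diff (increment (B := vect_affine R^o) f x 0).
  apply: (is_diff_eq (is_diffD (is_diff_cst _ _) (is_diff_comp fL u))).
  by apply/funext => h; rewrite fctE /= add0r coordsK.
set s := (fun h => f _) in fL.
have -> : increment (B := vect_affine R^o) f x =
    @coords R R^o \o (s - cst (f x)).
  by apply/funext => h; rewrite /s /= fctE.
have u := coords_diff ((s - cst (f x)) 0).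
apply: (is_diff_eq (is_diff_comp (is_diffB fL (is_diff_cst _ _)) u)).
by apply/funext => h; rewrite fctE /= subr0.
Qed.

End Differentials.

Section DifferentialCalculus.
Context (R : realType) (V : vectType R) (A : affine V).
Implicit Types (f g : A -> R) (L M : 'Hom(V, R^o)).

Lemma has_differentialD f g x L M :
  has_differential f x L -> has_differential g x M ->
  has_differential (fun y => f y + g y) x (L + M).
Proof.
move=> /has_differentialE fL /has_differentialE gM; apply/has_differentialE.
apply: (is_diff_eq (is_diffD fL gM)).
by apply/funext => h; rewrite add_lfunE.
Qed.

Lemma has_differentialN f x L :
  has_differential f x L -> has_differential (fun y => - f y) x (- L).
Proof.
move=> /has_differentialE fL; apply/has_differentialE.
apply: (is_diff_eq (is_diffN fL)).
by apply/funext => h; rewrite opp_lfunE.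
Qed.

Lemma has_differentialM f g x L M :
  has_differential f x L -> has_differential g x M ->
  has_differential (fun y => f y * g y) x (f x *: M + g x *: L).
Proof.
move=> /has_differentialE fL /has_differentialE gM; apply/has_differentialE.
apply: (is_diff_eq (is_diffM fL gM)).
apply/funext => h.
by rewrite add_lfunE !scale_lfunE linear0 aadd0.
Qed.

Lemma has_differential_cst (c : R) x : has_differential (fun _ : A => c) x 0.
Proof.
apply: (@has_tangent_affine _ _ _ A (vect_affine R^o)) => y v.
by rewrite zero_lfunE /= addr0.
Qed.

Lemma has_differential_sum I (r : seq I) (f : I -> A -> R) x
    (L : I -> 'Hom(V, R^o)) :
  (forall i, has_differential (f i) x (L i)) ->
  has_differential (fun y => \sum_(i <- r) f i y) x (\sum_(i <- r) L i).
Proof.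
move=> fL; elim: r => [|i r IHr].
  rewrite big_nil; under eq_fun do rewrite big_nil.
  exact: has_differential_cst.
rewrite big_cons; under eq_fun do rewrite big_cons.
exact: has_differentialD.
Qed.

Lemma has_tangent_differential f x L :
  has_differential f x L -> differential f x = L.
Proof. by move=> /has_tangentP[]. Qed.

End DifferentialCalculus.

Section AffineComposition.
Context (R : realType) (U V W : vectType R).
Context (A : affine U) (B : affine V) (C : affine W).

Lemma increment_affine_comp (pi : A -> B) (P : 'Hom(U, V)) (f : B -> C) x :
  (forall y v, pi (aadd y v) = aadd (pi y) (P v)) ->
  increment (f \o pi) x =
  increment f (pi x) \o (fun h => coords (P (uncoords h))).
Proof.
by move=> piP; apply/funext => h; rewrite /increment /= piP coordsK.
Qed.

Lemma has_tangent_affine_comp (pi : A -> B) (P : 'Hom(U, V)) (f : B -> C) x L :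
  (forall y v, pi (aadd y v) = aadd (pi y) (P v)) ->
  has_tangent f (pi x) L -> has_tangent (f \o pi) x (L \o P)%VF.
Proof.
move=> piP fL; rewrite /has_tangent (increment_affine_comp f x piP).
pose F : {linear 'rV_(\dim {:U}) -> 'rV_(\dim {:V})} :=
  @coords R V \o P \o @uncoords R U.
have cF : continuous F by exact: rV_linear_continuous.
have dF : is_diff 0 F F.
  by apply: DiffDef; [exact: linear_differentiable | rewrite (diff_lin _ cF)].
(* The chain rule asks for the outer differential at [F 0], which is [0] by linearity. *)
have fF : is_diff (F 0) (increment f (pi x)) (fun h => coords (L (uncoords h))).
  by rewrite linear0.
apply: (is_diff_eq (is_diff_comp dF fF)).
by apply/funext => h; rewrite /= comp_lfunE coordsK.
Qed.

End AffineComposition.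

Lemma differentiable_at_continuous (R : realType) (V W : vectType R)
    (A : affine V) (B : affine W) (f : A -> B) x :
  differentiable_at f x -> Defs.continuous_at f x.
Proof.
rewrite /differentiable_at /Defs.continuous_at => df.
exact: differentiable_continuous.
Qed.

(** * Smooth maps and their closure properties *)

Section Smoothness.
Context (R : realType) (V W : vectType R) (A : affine V) (B : affine W).

Lemma sub_Ck k (U U' : set A) (f : A -> B) : U' `<=` U -> Ck k U f -> Ck k U' f.
Proof.
elim: k W B f => [|k IHk] W' B' f U'U /=.
  by move=> fC x /U'U/fC.
case=> fd fC; split=> [x /U'U/fd//|v]; exact: IHk.
Qed.

(** Differentiability gives continuity at order zero; above it, the induction acts on the
    directional derivatives. *)
Lemma CkW k (U : set A) (f : A -> B) : Ck k.+1 U f -> Ck k U f.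
Proof.
elim: k W B f => [|k IHk] W' B' f [fd fC].
  by move=> x /fd fdx; exact: differentiable_at_continuous.
by split=> // v; apply: IHk.
Qed.

(* On [setT], derivatives can be replaced by equal functions without any
   appeal to the locality of differentiability; this is why the closure
   properties below are stated there and transported by [sub_Ck]. *)
Lemma has_tangent_Ck k (f : A -> B) (L : A -> 'Hom(V, W)) :
  (forall x, has_tangent f x (L x)) ->
  (forall v, Ck k (B := vect_affine W) setT (fun x => L x v)) ->
  Ck k.+1 setT f.
Proof.
move=> fL LC; split=> [x _|v]; first by have /has_tangentP[] := fL x.
suff -> : (fun x => tangent f x v) = (fun x => L x v) by [].
by apply/funext => x; have /has_tangentP[_ ->] := fL x.
Qed.

Lemma Ck_has_tangent k (f : A -> B) x :
  Ck k.+1 setT f -> has_tangent f x (tangent f x).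
Proof. by case=> fd _; apply/has_tangentP; split=> //; apply: fd. Qed.

Lemma smooth_has_tangent (f : A -> B) x :
  smooth setT f -> has_tangent f x (tangent f x).
Proof. by move=> /(_ 1%N)/Ck_has_tangent. Qed.

End Smoothness.

Section SmoothMaps.
Context (R : realType).

(** The derivative along a fixed vector is constant, hence affine with linear part [0], so the
    induction hypothesis applies to it. *)
Lemma smooth_affine (V W : vectType R) (A : affine V) (B : affine W)
    (f : A -> B) (L : 'Hom(V, W)) :
  (forall x v, f (aadd x v) = aadd (f x) (L v)) -> smooth setT f.
Proof.
move=> fL k; elim: k W B f L fL => [|k IHk] W' B' f L fL; last first.
  apply: (has_tangent_Ck (has_tangent_affine fL)) => v.
  by apply: (IHk _ _ _ 0) => x w; rewrite zero_lfunE /= addr0.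
move=> x _; apply: differentiable_at_continuous.
by have /has_tangentP[] := has_tangent_affine fL x.
Qed.

(** The derivative of [f \o pi] along [v] is the derivative of [f] along the fixed vector [P v],
    composed with [pi], so the induction closes. *)
Lemma Ck_affine_comp (U V W : vectType R) (A : affine U) (B : affine V)
    (C : affine W) (pi : A -> B) (P : 'Hom(U, V)) (f : B -> C) k :
  (forall y v, pi (aadd y v) = aadd (pi y) (P v)) ->
  Ck k setT f -> Ck k setT (f \o pi).
Proof.
move=> piP; elim: k W C f => [|k IHk] W' C' f fC.
  move=> x _; rewrite /Defs.continuous_at (increment_affine_comp f x piP).
  pose F : {linear 'rV_(\dim {:U}) -> 'rV_(\dim {:V})} :=
    @coords R V \o P \o @uncoords R U.
  have cF : continuous F by exact: rV_linear_continuous.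
  apply: continuous_comp; first exact: cF.
  have -> : coords (P (uncoords (0 : 'rV_(\dim {:U})))) = 0 by rewrite !linear0.
  exact: fC.
have fL x := Ck_has_tangent (pi x) fC.
apply: (has_tangent_Ck (fun x => has_tangent_affine_comp piP (fL x))) => v.
under eq_fun do rewrite comp_lfunE.
by apply: (IHk _ (vect_affine W') (fun y => tangent f y (P v))); apply: fC.2.
Qed.

Lemma smooth_comp_affine (U W : vectType R) (A : affine U) (B : affine W)
    (pi : A -> B) (P : 'Hom(U, W)) (f : B -> R) :
  (forall y v, pi (aadd y v) = aadd (pi y) (P v)) ->
  smooth_fun setT f -> smooth_fun setT (f \o pi).
Proof. by move=> piP fS k; exact: Ck_affine_comp piP (fS k). Qed.

End SmoothMaps.

Section SmoothFunctions.
Context (R : realType) (V : vectType R) (A : affine V).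
Implicit Types f g : A -> R.

Let CkR k f := Ck (B := vect_affine R^o) k setT f.

Lemma continuous_atE f x :
  Defs.continuous_at (B := vect_affine R^o) f x <->
  {for (0 : 'rV[R]_(\dim {:V})),
    continuous (fun h => f (aadd x (uncoords h)) : R)}.
Proof.
pose s (h : 'rV[R]_(\dim {:V})) : R := f (aadd x (uncoords h)).
rewrite /Defs.continuous_at -/s; split=> cf.
  have -> : s = cst (f x) +
      ((@uncoords R R^o : _ -> R) \o increment (B := vect_affine R^o) f x).
    by apply/funext => h; rewrite /s fctE /= coordsK /= addrC subrK.
  apply: continuousD; first exact: cst_continuous.
  apply: continuous_comp; first exact: cf.
  apply: differentiable_continuous.
  exact: (@ex_diff _ _ _ _ _ _ _ (uncoords_diff _)).
have -> : increment (B := vect_affine R^o) f x =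
    (@coords R R^o : R -> _) \o (s - cst (f x)).
  by apply/funext => h; rewrite /= fctE.
apply: continuous_comp.
  by apply: continuousB; [exact: cf|exact: cst_continuous].
apply: differentiable_continuous.
exact: (@ex_diff _ _ _ _ _ _ _ (coords_diff _)).
Qed.

Lemma CkD k f g : CkR k f -> CkR k g -> CkR k (fun x => f x + g x).
Proof.
elim: k f g => [|k IHk] f g fC gC.
  move=> x _; apply/continuous_atE.
  have /continuous_atE fc := fC x I; have /continuous_atE gc := gC x I.
  exact: continuousD fc gc.
have fL x := Ck_has_tangent x fC; have gL x := Ck_has_tangent x gC.
apply: (has_tangent_Ck (fun x => has_differentialD (fL x) (gL x))) => v.
under eq_fun do rewrite add_lfunE.
by apply: IHk; [apply: fC.2|apply: gC.2].
Qed.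

(** By the Leibniz rule a directional derivative is a sum of products, whose undifferentiated
    factors are brought down to order [k] by [CkW]. *)
Lemma CkM k f g : CkR k f -> CkR k g -> CkR k (fun x => f x * g x).
Proof.
elim: k f g => [|k IHk] f g fC gC.
  move=> x _; apply/continuous_atE.
  have /continuous_atE fc := fC x I; have /continuous_atE gc := gC x I.
  exact: continuousM fc gc.
have fL x := Ck_has_tangent x fC; have gL x := Ck_has_tangent x gC.
apply: (has_tangent_Ck (fun x => has_differentialM (fL x) (gL x))) => v.
have -> : (fun x => (f x *: tangent (B := vect_affine R^o) g x +
                     g x *: tangent (B := vect_affine R^o) f x) v) =
    (fun x => f x * tangent (B := vect_affine R^o) g x v +
              g x * tangent (B := vect_affine R^o) f x v).
  have combE (L M : 'Hom(V, R^o)) (a b : R) :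
    (a *: M + b *: L) v = a * M v + b * L v by rewrite add_lfunE !scale_lfunE.
  by apply/funext => x; exact: combE.
exact: (CkD (IHk _ _ (CkW fC) (gC.2 v)) (IHk _ _ (CkW gC) (fC.2 v))).
Qed.

Lemma smooth_cst (c : R) : smooth_fun setT (fun _ : A => c).
Proof.
apply: (@smooth_affine _ _ _ A (vect_affine R^o) _ 0) => x v.
by rewrite zero_lfunE /= addr0.
Qed.

Lemma smoothD f g :
  smooth_fun setT f -> smooth_fun setT g ->
  smooth_fun setT (fun x => f x + g x).
Proof. by move=> fS gS k; apply: CkD; [apply: fS|apply: gS]. Qed.

Lemma smoothM f g :
  smooth_fun setT f -> smooth_fun setT g ->
  smooth_fun setT (fun x => f x * g x).
Proof. by move=> fS gS k; apply: CkM; [apply: fS|apply: gS]. Qed.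

Lemma smoothN f : smooth_fun setT f -> smooth_fun setT (fun x => - f x).
Proof.
move=> fS; under eq_fun do rewrite -mulN1r.
exact: smoothM (smooth_cst _) fS.
Qed.

Lemma smooth_sum I (r : seq I) (f : I -> A -> R) :
  (forall i, smooth_fun setT (f i)) ->
  smooth_fun setT (fun x => \sum_(i <- r) f i x).
Proof.
move=> fS; elim: r => [|i r IHr].
  under eq_fun do rewrite big_nil.
  exact: smooth_cst.
under eq_fun do rewrite big_cons.
exact: smoothD.
Qed.

End SmoothFunctions.

(** * Linear and quadratic functions *)

Section LinearFunctionals.
Context (R : realType) (W : vectType R).

Lemma smooth_linear (l : 'Hom(W, R^o)) :
  smooth_fun (A := vect_affine W) setT (l : W -> R).
Proof.
apply: (@smooth_affine _ _ _ _ (vect_affine R^o) _ l) => x v.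
exact: linearD.
Qed.

Lemma has_differential_linear (l : 'Hom(W, R^o)) (x : W) :
  has_differential (A := vect_affine W) (l : W -> R) x l.
Proof.
apply: (@has_tangent_affine _ _ _ _ (vect_affine R^o)) => y v.
exact: linearD.
Qed.

(* Expanding one argument in a basis makes [b x x] a sum of products of linear
   functionals, so that no estimate is needed to differentiate it. *)
Variable b : 'Hom(W, 'Hom(W, R^o)).
Let e := vbasis {:W}.
Let c (i : 'I_(\dim {:W})) : 'Hom(W, R^o) := linfun (coord e i : W -> R^o).

Fact coordlE i x : c i x = coord e i x. Proof. exact: lfunE. Qed.

Fact bilinear_coord x v : b x v = \sum_i c i x * b e`_i v.
Proof.
rewrite {1}(coord_vbasis (memvf x)) linear_sum sum_lfunE.
by apply: eq_bigr => i _; rewrite linearZ scale_lfunE coordlE.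
Qed.

Lemma smooth_quadratic :
  smooth_fun (A := vect_affine W) setT (fun x => b x x).
Proof.
have -> : (fun x : W => b x x : R) = (fun x => \sum_i c i x * b e`_i x).
  by apply/funext => x; exact: bilinear_coord.
apply: (@smooth_sum _ _ (vect_affine W)) => i.
by apply: (@smoothM _ _ (vect_affine W)); exact: smooth_linear.
Qed.

Hypothesis b_sym : forall x y, b x y = b y x.

Lemma has_differential_quadratic (x : W) :
  has_differential (A := vect_affine W) (fun y => b y y) x (2%:R *: b x).
Proof.
have -> : (fun x : W => b x x : R) = (fun x => \sum_i c i x * b e`_i x).
  by apply/funext => y; exact: bilinear_coord.
(* The sum is what the Leibniz rule yields term by term; by symmetry each of its two halves is
   [b x]. *)
have -> : 2%:R *: b x = \sum_i (c i x *: b e`_i + b e`_i x *: c i).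
  apply/lfunP => v; rewrite sum_lfunE scale_lfunE scaler_nat mulr2n.
  rewrite {1}bilinear_coord b_sym bilinear_coord -big_split /=.
  apply: eq_bigr => i _; rewrite add_lfunE scale_lfunE scale_lfunE.
  by rewrite [X in _ = _ + X]mulrC.
apply: (@has_differential_sum _ _ (vect_affine W)) => i.
apply: (@has_differentialM _ _ (vect_affine W)); exact: has_differential_linear.
Qed.

End LinearFunctionals.

Lemma asubDr (R : realType) (V : vectType R) (A : affine V) (x y : A) (v : V) :
  asub (aadd y v) x = asub y x + v.
Proof. by rewrite -[y in LHS](asubK x) aaddA aaddK. Qed.

(** * Momenta, frames and the dynamics *)

Section Momenta.
Context (R : realType) (S : newtonian R).
Local Notation V := (nV S).
Local Notation Vd := ('Hom(nV S, R^o)).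
Local Notation tau := (ntau S).
Local Notation g := (ng S).
Local Notation cast := (vsproj (lker (ntau S))).

Lemma metric_inj : injective g.
Proof.
move=> a b gab; apply/eqP; rewrite -subr_eq0; apply/negPn/negP => /ng_pos.
have -> : g (a - b) = 0 by rewrite linearB /= gab subrr.
by rewrite zero_lfunE ltxx.
Qed.

(** Positivity makes [g] injective, and [E0] and its dual have equal dimension, so [g] is onto. *)
Lemma metric_invK (q : 'Hom(E0 S, R^o)) : g ((g^-1)%VF q) = q.
Proof.
have g0 : lker g == 0%VS by apply/lker0P; exact: metric_inj.
have gT : limg g = fullv.
  apply/eqP; rewrite eqEdim subvf /= dim_dual.
  by rewrite limg_dim_eq // (eqP g0) capv0.
by rewrite limg_lfunVK // gT memvf.
Qed.

(** This is [gprime p] kept inside [E0], where the metric can be applied to it. *)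
Definition spatial (p : Vd) : E0 S := (g^-1)%VF (p \o inclusion S)%VF.

Lemma metric_spatial (p : Vd) (w : E0 S) : g (spatial p) w = p (vsval w).
Proof. by rewrite metric_invK comp_lfunE inclusionE. Qed.

Lemma gprimeE (p : Vd) : gprime p = vsval (spatial p).
Proof. exact: inclusionE. Qed.

Lemma spatial_unique (p : Vd) (a : E0 S) :
  (forall w : E0 S, p (vsval w) = g a w) -> spatial p = a.
Proof.
by move=> pa; apply/metric_inj/lfunP => w; rewrite metric_spatial pa.
Qed.

Lemma gprime_pairing (p q : Vd) : p (gprime q) = g (spatial p) (spatial q).
Proof. by rewrite gprimeE metric_spatial. Qed.

Lemma spatial_is_linear : linear spatial.
Proof.
move=> a p q; apply: spatial_unique => w.
by rewrite gDl gZl !metric_spatial add_lfunE scale_lfunE.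
Qed.

Lemma gprime_is_linear : linear (@gprime R S).
Proof. by move=> a p q; rewrite !gprimeE spatial_is_linear linearP. Qed.

Lemma tau_vsval (w : E0 S) : tau (vsval w) = 0.
Proof. by apply/eqP; rewrite -memv_ker; exact: subvsP. Qed.

Lemma E1P (u : E1 S) : tau (val u) = 1.
Proof. exact: (eqP (valP u)). Qed.

Lemma vsval_iota (u : E1 S) (v : V) :
  vsval (iota_ (val u) v) = v - (tau v : R) *: val u.
Proof.
rewrite iotaE vsprojK // memv_ker linearB linearZ /= E1P.
by apply/eqP; rewrite /GRing.scale /= mulr1 subrr.
Qed.

Lemma iota_vsval (u : V) (w : E0 S) : iota_ u (vsval w) = w.
Proof. by rewrite iotaE tau_vsval scale0r subr0 vsvalK. Qed.

Lemma iota_frame (u : E1 S) : iota_ (val u) (val u) = 0.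
Proof. by apply: subvs_inj; rewrite vsval_iota E1P scale1r subrr. Qed.

Lemma momentum_split (u : E1 S) (p : Vd) :
  p = iota_dual (val u) (g (spatial p)) + (p (val u) : R) *: tau.
Proof.
apply/lfunP => v; rewrite add_lfunE scale_lfunE comp_lfunE metric_spatial.
rewrite vsval_iota linearB linearZ /=.
by rewrite /GRing.scale /= [X in _ - X]mulrC subrK.
Qed.

(** [V] is the direct sum of [E0] and the line of [u], so a covector amounts to its restriction to
    [E0] and its value at [u]. The formula for [p] in [D_hu] thus splits into two equations. *)
Lemma momentum_splitP (u : E1 S) (a : E0 S) (s : R) (p : Vd) :
  p = iota_dual (val u) (g a) + s *: tau <-> spatial p = a /\ p (val u) = s.
Proof.
split=> [->|[<- <-]]; last exact: momentum_split.
split; last first.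
  rewrite add_lfunE scale_lfunE comp_lfunE iota_frame linear0 E1P.
  by rewrite add0r /GRing.scale /= mulr1.
apply: spatial_unique => w.
by rewrite add_lfunE scale_lfunE comp_lfunE iota_vsval tau_vsval scaler0 addr0.
Qed.

(** * Change of frame and the dynamics in a fixed frame *)

Section Frames.
Variables (m : R) (m_gt0 : 0 < m).

Lemma psiE (u : E1 S) x (p : Vd) :
  psi m u x p = (2 * m)^-1 * g (spatial p) (spatial p) + p (val u).
Proof. by rewrite /psi gprime_pairing. Qed.

(** Since [tau] vanishes on [E0], the quadratic correction in [sigma] disappears there. *)
Lemma spatial_frame_change (u u' : E1 S) (p : Vd) :
  spatial (p + m *: sigma u' u) = spatial p + m *: cast (val u' - val u).
Proof.
apply: spatial_unique => w.
rewrite gDl gZl metric_spatial add_lfunE scale_lfunE sigmaE tau_vsval.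
by rewrite scale0r subr0 vsvalK mul0r mul0r subr0.
Qed.

Lemma psi_frame_change (u u' : E1 S) x (p p' : Vd) :
  frame_rel m (u, p) (u', p') -> psi m u x p = psi m u' x p'.
Proof.
move=> /eqP /= ->; rewrite !psiE spatial_frame_change.
set d := cast _.
(* This turns [p' (val u)] into [p' (val u')] minus [g (spatial p') d]. In [sigma u' u (val u)] only
   [- g d d / 2] survives, because [iota_ u] kills [u]. *)
have uE : val u = val u' - vsval d by rewrite vsprojK ?E1B// opprB addrC subrK.
rewrite add_lfunE scale_lfunE sigmaE -/d E1P scale1r subrr !linear0.
rewrite [in p' (val u)]uE linearB /= -metric_spatial.
rewrite !gDl !gDr !gZl !gZr (ng_sym d).
set a := g (spatial p') _; set k := g (spatial p') d; set l := g d d.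
(* The cross term [2 m k / (2 m)] cancels [- k], and [m ^ 2 l / (2 m)] cancels [- m l / 2]. *)
have id (s : R) : (2 * m)^-1 * (a + m * k + (m * k + m * (m * l))) +
    (s - k + m * (0 - 1 / 2 * l)) = (2 * m)^-1 * a + s.
  by field; rewrite gt_eqF.
exact: id.
Qed.

Variable phi : nN S -> R.

(** The parameter [t] is [tau v]. By [momentum_splitP] the equation for [p] fixes [spatial p], which
    is solved for [v], and [p (val u)], which becomes the mass shell condition. *)
Lemma D_huP (u : E1 S) x (p : Vd) xdot pdot :
  D_hu m phi u ((x, p), (xdot, pdot)) <->
  exists t : R, [/\ 0 < t, psi m u x p + phi x = 0,
    xdot = t *: (m^-1 *: gprime p + val u) &
    pdot = - t *: differential phi x].
Proof.
have regroup (w : E0 S) (k b c : R) :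
    k *: iota_dual (val u) (g w) - b *: tau - c *: tau =
    iota_dual (val u) (g (k *: w)) + (- b - c) *: tau.
  have -> : g (k *: w) = k *: g w by exact: linearZ.
  by rewrite /iota_dual comp_lfunZl scalerBl scaleNr addrA.
split.
  case=> v [t0 -> ->]; rewrite regroup => /momentum_splitP[sp pu].
  move: t0 sp pu; set t : R := tau v => t0 sp pu.
  have mt : m != 0 /\ t != 0 by rewrite !gt_eqF.
  exists t; split=> //.
    rewrite psiE sp pu gZl gZr; set a := g _ _; set c := phi x.
    by field; case: mt => -> ->.
  rewrite gprimeE sp linearZ /= vsval_iota -/t [(m / t) *: _]scalerA.
  have -> : m / t * m^-1 = t^-1 by field; case: mt => -> ->.
  by rewrite scalerDr scalerA mulfV ?mt.2 // scale1r subrK.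
case=> t [t0 psi0 -> ->].
have mt : m != 0 /\ t != 0 by rewrite !gt_eqF.
(* The velocity itself is the witness; [gprime p] is spacelike and [tau u = 1], so [tau] takes the
   value [t] on it. *)
exists (t *: (m^-1 *: gprime p + val u)).
have tauE : tau (t *: (m^-1 *: gprime p + val u)) = t.
  by rewrite linearZ linearD linearZ /= E1P gprimeE tau_vsval scaler0 add0r
    /GRing.scale /= mulr1.
have iotaE :
    iota_ (val u) (t *: (m^-1 *: gprime p + val u)) = (t / m) *: spatial p.
  rewrite linearZ linearD linearZ /= gprimeE iota_vsval iota_frame addr0.
  by rewrite scalerA.
rewrite /= tauE iotaE; split=> //.
rewrite regroup; apply/momentum_splitP; split.
  rewrite scalerA; have -> : m / t * (t / m) = 1 by field; case: mt => -> ->.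
  by rewrite scale1r.
move: psi0; rewrite psiE gZl gZr; set a := g _ _; set c := phi x => psi0.
have -> : p (val u) = - (2 * m)^-1 * a - c.
  by apply/eqP; rewrite -subr_eq0 -psi0; apply/eqP; ring.
by field; case: mt => -> ->.
Qed.

End Frames.

End Momenta.

(** * The function on phase space and the differential of the family *)

Section Hamiltonian.
Context (R : realType) (S : newtonian R).
Local Notation V := (nV S).
Local Notation Vd := ('Hom(nV S, R^o)).

Definition gprime_lfun : 'Hom(Vd, V) := linfun (@gprime R S).

Lemma gprime_lfunE p : gprime_lfun p = gprime p.
Proof.
pose F : {linear Vd -> V} := HB.pack (@gprime R S)
  (GRing.isLinear.Build R Vd V *:%R _ (@gprime_is_linear R S)).
exact: (lfunE F).
Qed.

(** The kinetic term is bundled as a bilinear form on the dual, so that the calculus of quadratic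
    functions applies to it. *)
Definition kinetic_form : 'Hom(Vd, 'Hom(Vd, R^o)) :=
  linfun (fun p : Vd => (p \o gprime_lfun)%VF : 'Hom(Vd, R^o)).

Lemma kinetic_formE (p q : Vd) : kinetic_form p q = p (gprime q).
Proof.
have pl : linear (fun p : Vd => (p \o gprime_lfun)%VF : 'Hom(Vd, R^o)).
  by move=> a p1 p2; rewrite comp_lfunDl comp_lfunZl.
pose F : {linear Vd -> 'Hom(Vd, R^o)} := HB.pack
  (fun p : Vd => (p \o gprime_lfun)%VF : 'Hom(Vd, R^o))
  (GRing.isLinear.Build R Vd 'Hom(Vd, R^o) *:%R _ pl).
have := lfunE F p; rewrite /kinetic_form => ->.
by rewrite /= comp_lfunE gprime_lfunE.
Qed.

Lemma kinetic_form_sym (p q : Vd) : kinetic_form p q = kinetic_form q p.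
Proof. by rewrite !kinetic_formE !gprime_pairing ng_sym. Qed.

(** The canonical map from [V] to its bidual, through which velocities appear in differentials along
    momenta. *)
Definition eval_lfun (v : V) : 'Hom(Vd, R^o) :=
  linfun (fun p : Vd => p v : R^o).

Lemma eval_lfunE (v : V) (p : Vd) : eval_lfun v p = p v.
Proof.
have pl : linear (fun p : Vd => p v : R^o).
  by move=> a p1 p2; rewrite add_lfunE scale_lfunE.
pose F : {linear Vd -> R^o} := HB.pack (fun p : Vd => p v : R^o)
  (GRing.isLinear.Build R Vd R^o *:%R _ pl).
exact: (lfunE F).
Qed.

Variables (m : R) (m_gt0 : 0 < m) (phi : nN S -> R).
Hypothesis phi_smooth : smooth_fun setT phi.

(** Evaluated at the chosen representative of the class; invariance of [psi] under [frame_rel] makes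
    the choice irrelevant. *)
Definition phase_psi (z : NP S m) : R := psi m (repr z.2).1 z.1 (repr z.2).2.

Lemma phase_psiE (u : E1 S) (x : nN S) (p : Vd) :
  phase_psi (x, cls m u p) = psi m u x p.
Proof.
apply: psi_frame_change => //; rewrite /frame_rel -surjective_pairing /=.
apply/eqP/cls_eqP.
by rewrite /cls -surjective_pairing reprK.
Qed.

Definition frame_psi (u : E1 S) (q : Vd) : R :=
  (2 * m)^-1 * kinetic_form q q + eval_lfun (val u) q.

(** The affine chart of the phase space given by a frame: it sends the class of [(u, p)] to [p]. *)
Definition frame_momentum (u : E1 S) (z : NP S m) : Vd :=
  asub (z.2 : phase_space S m) (cls m u 0).

(** In a fixed chart the function is a quadratic polynomial on the dual, so smoothness and
    differentials reduce to composition with an affine map. *)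
Lemma phase_psi_frame (u : E1 S) : phase_psi = frame_psi u \o frame_momentum u.
Proof.
apply/funext => -[x P]; rewrite /= /frame_momentum /=.
rewrite /frame_psi kinetic_formE eval_lfunE.
have {1}-> : P = cls m u (frame_momentum u (x, P)).
  by rewrite -[LHS](asubK (cls m u 0 : phase_space S m)) /= phase_addE add0r.
by rewrite phase_psiE.
Qed.

Lemma frame_momentum_affine (u : E1 S) (z : NP S m) h :
  frame_momentum u (aadd z h) = aadd (frame_momentum u z : vect_affine Vd)
    ((linfun snd : 'Hom((V * Vd)%type, Vd)) h).
Proof. by rewrite lfunE /= -asubDr. Qed.

Lemma smooth_frame_psi u : smooth_fun (A := vect_affine Vd) setT (frame_psi u).
Proof.
apply: (@smoothD _ _ (vect_affine Vd)); last exact: smooth_linear.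
apply: (@smoothM _ _ (vect_affine Vd)); first exact: smooth_cst.
exact: smooth_quadratic.
Qed.

Lemma has_differential_frame_psi u q :
  has_differential (A := vect_affine Vd) (frame_psi u) q
    (eval_lfun (m^-1 *: gprime q + val u)).
Proof.
(* The right-hand side has the shape produced by the sum and product rules; the term with [*: 0]
   comes from the constant factor [(2 * m)^-1]. *)
have -> : eval_lfun (m^-1 *: gprime q + val u) =
  ((2 * m)^-1 *: (2%:R *: kinetic_form q) + kinetic_form q q *: 0)
  + eval_lfun (val u).
  apply/lfunP => p; rewrite !add_lfunE scaler0 zero_lfunE addr0 scalerA.
  rewrite scale_lfunE !eval_lfunE kinetic_form_sym kinetic_formE.
  rewrite linearD linearZ /=; congr (_ *: _ + _).
  by field; rewrite gt_eqF.
apply: (@has_differentialD _ _ (vect_affine Vd)); last first.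
  exact: has_differential_linear.
apply: (@has_differentialM _ _ (vect_affine Vd)).
  exact: has_differential_cst.
exact/has_differential_quadratic/kinetic_form_sym.
Qed.

Lemma E1_inhabited : inhabited (E1 S).
Proof. by have [P] := phase_inhabited S m; exists; exact: (repr P).1. Qed.

Lemma smooth_phase_psi : smooth_fun (A := NP S m) setT phase_psi.
Proof.
have [u] := E1_inhabited; rewrite (phase_psi_frame u).
exact: (smooth_comp_affine (A := NP S m) (B := vect_affine Vd)
  (frame_momentum_affine u) (smooth_frame_psi u)).
Qed.

Lemma has_differential_phase_psi x u p :
  has_differential (A := NP S m) phase_psi (x, cls m u p)
    (eval_lfun (m^-1 *: gprime p + val u) \o linfun snd)%VF.
Proof.
rewrite (phase_psi_frame u).
have pE : frame_momentum u (x, cls m u p) = p.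
  have -> : (cls m u p : phase_space S m) =
      aadd (cls m u 0 : phase_space S m) p.
    by rewrite /= phase_addE add0r.
  exact: aaddK.
apply: (has_tangent_affine_comp (B := vect_affine Vd)
  (frame_momentum_affine u)).
by rewrite pE; exact: has_differential_frame_psi.
Qed.

Local Notation NPR := (NPR S m).

Lemma config_affine (z : NP S m) h : (aadd z h).1 =
  aadd z.1 ((linfun fst : 'Hom((V * Vd)%type, V)) h).
Proof. by rewrite lfunE. Qed.

Lemma base_affine (y : NPR) h : (aadd y h).1 =
  aadd y.1 ((linfun fst : 'Hom(((V * Vd) * R^o)%type, (V * Vd)%type)) h).
Proof. by rewrite lfunE. Qed.

Lemma scale_affine (y : NPR) h : ((aadd y h).2 : vect_affine R^o) =
  aadd (y.2 : vect_affine R^o)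
    ((linfun snd : 'Hom(((V * Vd) * R^o)%type, R^o)) h).
Proof. by rewrite lfunE. Qed.

Definition energy (z : NP S m) : R := phase_psi z + phi z.1.

Lemma H_hE : (fun y : NPR => - H_h phi phase_psi y) =
  (fun y : NPR => - ((y.2 : R) * (energy \o fst) y)).
Proof. by apply/funext => -[[x P] r]. Qed.

Lemma smooth_H_h : smooth_fun (A := NPR) setT (fun y => - H_h phi phase_psi y).
Proof.
rewrite H_hE; apply: (@smoothN _ _ NPR); apply: (@smoothM _ _ NPR).
  exact: (smooth_affine (B := vect_affine R^o) scale_affine).
apply: (smooth_comp_affine base_affine).
apply: (@smoothD _ _ (NP S m)); first exact: smooth_phase_psi.
exact: (smooth_comp_affine config_affine phi_smooth).
Qed.

(** Evaluation at a vector [h] lets the generating condition be tested separately along the base and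
    along the fibre coordinate [r]. *)
Lemma differential_H_h x u p (r : R) (h : ((V * Vd) * R^o)%type) :
  differential (A := NPR) (fun y => - H_h phi phase_psi y)
    ((x, cls m u p), r) h =
  - (r * (h.1.2 (m^-1 *: gprime p + val u) + differential phi x h.1.1)
     + (psi m u x p + phi x) * h.2).
Proof.
rewrite H_hE.
have dphi : has_differential (A := NP S m) (fun z => phi z.1) (x, cls m u p)
    (differential phi x \o linfun fst)%VF.
  exact: (has_tangent_affine_comp (A := NP S m) (x := (x, cls m u p))
    config_affine (smooth_has_tangent x phi_smooth)).
have dE := has_differentialD (has_differential_phase_psi x u p) dphi.
have dE' := has_tangent_affine_comp (A := NPR) (x := ((x, cls m u p), r))
  base_affine dE.
have dr : has_differential (A := NPR) (fun y => y.2 : R)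
    ((x, cls m u p), r) (linfun snd).
  exact: (has_tangent_affine (B := vect_affine R^o) scale_affine).
have dF := has_differentialN (has_differentialM dr dE').
rewrite (has_tangent_differential dF) opp_lfunE add_lfunE !scale_lfunE.
rewrite !comp_lfunE add_lfunE !comp_lfunE !lfunE /=.
by rewrite eval_lfunE /energy phase_psiE.
Qed.

End Hamiltonian.

(** * The half space as a family over its base, and the set it generates *)

Lemma tangent_base (R : realType) (S : newtonian R) (m : R) (y : NPR S m) :
  tangent (A := NPR S m) (B := NP S m) fst y = linfun fst.
Proof.
by have /has_tangentP[] := has_tangent_affine (@base_affine R S m) y.
Qed.

Lemma half_space_open (R : realType) (S : newtonian R) (m : R) :
  affine_open (half_space S m).
Proof.
move=> y y0.
pose l : {linear 'rV[R]_(\dim {:((nV S * 'Hom(nV S, R^o)) * R^o)%type}) -> R} :=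
  snd \o @uncoords R ((nV S * 'Hom(nV S, R^o)) * R^o)%type.
have lc : {for 0, continuous l} by exact: rV_linear_continuous.
have : \forall h \near (0 : 'rV[R]_(\dim
    {:((nV S * 'Hom(nV S, R^o)) * R^o)%type})), - (y.2 : R) < l h.
  by apply: (cvgr_gt (l 0) lc); rewrite linear0 oppr_lt0.
by apply: filterS => h; rewrite -subr_gt0 opprK addrC.
Qed.

Lemma half_space_submersion (R : realType) (S : newtonian R) (m : R) :
  surjective_submersion (A := NPR S m) (B := NP S m) (half_space S m) fst.
Proof.
split.
- exact: half_space_open.
- move=> k; apply: (@sub_Ck _ _ _ _ _ k setT) => //.
  exact: (smooth_affine (@base_affine R S m)).
- move=> y _; rewrite tangent_base; apply/vspaceP => v; rewrite memvf.
  by apply/memv_imgP; exists (v, 0); rewrite ?memvf // lfunE.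
- by move=> q; exists (q, 1) => //; exact: ltr01.
Qed.

Lemma generated_H_h (R : realType) (S : newtonian R) (m : R) (phi : nN S -> R)
    (m_gt0 : 0 < m) (phi_smooth : smooth_fun setT phi) :
  generated (A := NPR S m) (B := NP S m) (half_space S m) fst
    (fun y => - H_h phi (@phase_psi R S m) y) = beta @` D_h m phi.
Proof.
apply/seteqP; split=> [[q b]|_ [[[x P] [xdot pdot]] [u [p [-> Dz]]] <-]].
  case=> -[[x P] r] [/= r0 <-]; have [u [p ->]] := phaseP P.
  rewrite tangent_base => dH.
  have val_dH h : (b \o linfun fst)%VF h = _ :=
    etrans (congr1 (fun L : 'Hom(_, R^o) => L h) (esym dH))
      (differential_H_h m_gt0 phi_smooth x u p r h).
  pose w := m^-1 *: gprime p + val u.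
  (* Velocity and force are those of [D_huP] with [t = r]. *)
  exists ((x, cls m u p), (r *: w, - r *: differential phi x)).
    exists u, p; split=> //; apply/(D_huP m_gt0); exists r; split=> //.
    (* The vertical vector is killed by the projection, so the [r]-derivative vanishes: this is the
       mass shell condition. *)
    have := val_dH (0, 1); rewrite comp_lfunE lfunE /= linear0.
    rewrite zero_lfunE linear0 addr0 mulr0 add0r mulr1 => /eqP.
    by rewrite eq_sym oppr_eq0 => /eqP.
  rewrite /beta /=; congr pair; apply/lfunP => h.
  (* Horizontal vectors recover the whole covector [b]; the minus sign of the family matches the one
     in [beta]. *)
  have := val_dH (h, 0); rewrite comp_lfunE lfunE /= => ->.
  rewrite covectorE scale_lfunE -scaleNr linearZ /= mulr0 addr0 mulrDr opprD.
  by rewrite addrC; congr (_ + _); exact: mulNr.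
have /(D_huP m_gt0)[t [t0 psi0 -> ->]] := Dz.
(* The fibre coordinate is the time component [t] of the velocity, and the mass shell condition
   removes the vertical part of the differential. *)
exists ((x, cls m u p), t); split=> //.
rewrite tangent_base; apply/lfunP => h.
rewrite differential_H_h // comp_lfunE lfunE /= covectorE psi0.
rewrite scale_lfunE -scaleNr linearZ /= mul0r addr0 mulrDr opprD.
by rewrite addrC; congr (_ + _); apply/esym; exact: mulNr.
Qed.

Theorem mainTheorem2 (R : realType) (S : newtonian R) (m : R) (phi : nN S -> R)
    (m_gt0 : 0 < m) (phi_smooth : smooth_fun setT phi) :
  (forall (u u' : E1 S) (x : nN S) (p p' : 'Hom(nV S, R^o)),
     frame_rel m (u, p) (u', p') -> psi m u x p = psi m u' x p') /\
  exists Psi : NP S m -> R,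
    (forall (u : E1 S) (x : nN S) (p : 'Hom(nV S, R^o)),
       Psi (x, cls m u p) = psi m u x p) /\
    generates (B := NP S m) (half_space S m) fst
      (fun y => - H_h phi Psi y)
      (beta @` D_h m phi).
Proof.
split; first by move=> u u' x p p'; exact: psi_frame_change.
exists (@phase_psi R S m); split; first exact: phase_psiE.
split.
- exact: half_space_submersion.
(* The formula is smooth for every real [r], so smoothness is restricted from the whole affine
   space. *)
- move=> k; apply: (@sub_Ck _ _ _ _ _ k setT) => //.
  exact: smooth_H_h.
- exact: generated_H_h.
Qed.
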